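(* Let $\mathfrak n$ be a (nonzero, finite-dimensional, real) nilpotent Lie algebra with Lie bracket $[\,,\,]$ and let $\omega$ be a symplectic structure on $\mathfrak n$. Let $\tilde{\mathfrak n}=\mathfrak n\oplus\mathbb R z$, where $z\notin\mathfrak n$, be endowed with the bracket $[[\,,\,]]$ given by $$[[x,y]]=[x,y]+\omega(x,y)\,z,\qquad [[x,z]]=0\qquad\text{for all }x,y\in\mathfrak n .$$ Then $\tilde{\mathfrak n}$ is nilpotent and $$\dim E_\infty^{0,2}(\mathfrak n)=\dim E_\infty^{1,1}(\tilde{\mathfrak n})+1 .$$ In particular $E_\infty^{0,2}(\mathfrak n)\neq 0$.
   Context: All Lie algebras are real, finite-dimensional and nonzero. For a Lie algebra $\mathfrak g$, the central descending series is $\mathfrak g^0=\mathfrak g$, $\mathfrak g^i=[\mathfrak g,\mathfrak g^{i-1}]$ for $i\ge 1$; $\mathfrak g$ is $k$-step nilpotent (nilpotency index $k$) if $\mathfrak g^k=0$ and $\mathfrak g^{k-1}\ne 0$ (so nonzero abelian Lie algebras are 1-step nilpotent). The Chevalley–Eilenberg differential $d:\Lambda^p\mathfrak g^*\to\Lambda^{p+1}\mathfrak g^*$ (trivial coefficients) is $$dc(x_1,\dots,x_{p+1})=\sum_{1\le i<j\le p+1}(-1)^{i+j-1}c([x_i,x_j],x_1,\dots,\hat{x_i},\dots,\hat{x_j},\dots,x_{p+1}).$$ A symplectic structure on a Lie algebra $\mathfrak g$ is a 2-form $\omega\in\Lambda^2\mathfrak g^*$ which is closed ($d\omega=0$) and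 non-degenerate. For a nilpotent Lie algebra $\mathfrak n$ of nilpotency index $k$, define subspaces of $\mathfrak n^*$ by $V_0=0$ and $V_i=\{\alpha\in\mathfrak n^*: d\alpha\in\Lambda^2V_{i-1}\}$ for $i\ge1$; $V_i$ is the annihilator of $\mathfrak n^i$, and $V_k=\mathfrak n^*$. The subcomplexes $F^pC^*=\Lambda^*V_{k-p}$ filter the Chevalley–Eilenberg complex, and $E_\infty^{p,q}(\mathfrak n)$ (the intermediate cohomology groups) denote the limit terms of the resulting spectral sequence; explicitly $$E_\infty^{p,q}(\mathfrak n)\cong\frac{\{x\in\Lambda^{p+q}V_{k-p}:dx=0\}}{d(\{x\in\Lambda^{p+q-1}\mathfrak n^*:dx\in\Lambda^{p+q}V_{k-p}\})+\{x\in\Lambda^{p+q}V_{k-p-1}:dx=0\}} .$$ In particular $E_\infty^{0,2}(\mathfrak n)\cong\{x\in\Lambda^2\mathfrak n^*:dx=0\}/\{x\in\Lambda^2V_{k-1}:dx=0\}$. For $\tilde{\mathfrak n}$ the group $E_\infty^{1,1}(\tilde{\mathfrak n})$ is computed with the nilpotency index and the filtration of $\tilde{\mathfrak n}$. *)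

(* Defs.v *)
From HB Require Import structures.
From mathcomp Require Import all_boot all_order all_algebra perm zify.
From mathcomp Require Import all_classical reals.

Set Implicit Arguments.
Unset Strict Implicit.
Unset Printing Implicit Defensive.

Import Order.TTheory GRing.Theory Num.Theory.
Local Open Scope ring_scope.

HB.mixin Record Vector_isLie (R : realType) (g : Type) of Vector R g := {
  lie : g -> g -> g;
  lieDl : forall (a : R) (x y z : g),
    lie (a *: x + y) z = a *: lie x z + lie y z;
  lieDr : forall (a : R) (x y z : g),
    lie x (a *: y + z) = a *: lie x y + lie x z;
  liexx : forall x : g, lie x x = 0;
  jacobi : forall x y z : g,
    lie x (lie y z) + lie y (lie z x) + lie z (lie x y) = 0
}.

#[short(type="lieAlgType")]
HB.structure Definition LieAlgebra (R : realType) :=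
  { g of Vector R g & Vector_isLie R g }.

Section LieTheory.
Variables (R : realType) (g : lieAlgType R).
Implicit Types (x y z : g) (U V W : {vspace g}).

Lemma lie0x x : lie 0 x = 0.
Proof. by have := lieDl (-1) 0 0 x; rewrite scaler0 addr0 scaleN1r addNr. Qed.
Lemma liex0 x : lie x 0 = 0.
Proof. by have := lieDr (-1) x 0 0; rewrite scaler0 addr0 scaleN1r addNr. Qed.
Lemma lieZl a x y : lie (a *: x) y = a *: lie x y.
Proof. by have := lieDl a x 0 y; rewrite !addr0 lie0x addr0. Qed.
Lemma lieZr a x y : lie x (a *: y) = a *: lie x y.
Proof. by have := lieDr a x y 0; rewrite !addr0 liex0 addr0. Qed.
Lemma lieAl x y z : lie (x + y) z = lie x z + lie y z.
Proof. by have := lieDl 1 x y z; rewrite !scale1r. Qed.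
Lemma lieAr x y z : lie x (y + z) = lie x y + lie x z.
Proof. by have := lieDr 1 x y z; rewrite !scale1r. Qed.
Lemma lieC x y : lie y x = - lie x y.
Proof.
have := liexx (x + y); rewrite lieAl !lieAr !liexx add0r addr0 => /eqP.
by rewrite addrC addr_eq0 => /eqP.
Qed.

(* [U, V], the span of all brackets: spanned by those of basis vectors, see
   lie_spanP. *)
Definition lie_span U V : {vspace g} :=
  <<[seq lie u v | u <- vbasis U, v <- vbasis V]>>%VS.

Lemma memv_lie U V u v : u \in U -> v \in V -> lie u v \in lie_span U V.
Proof.
move=> /coord_vbasis-> /coord_vbasis->.
elim/big_rec: _ => [|i x _ IH]; first by rewrite lie0x mem0v.
rewrite lieDl rpredD // rpredZ //.
elim/big_rec: _ => [|j y _ IHy]; first by rewrite liex0 mem0v.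
rewrite lieDr rpredD // rpredZ // memv_span //.
by apply/allpairsP; exists ((vbasis U)`_i, (vbasis V)`_j);
  split=> //; rewrite mem_nth // size_tuple.
Qed.

Lemma lie_spanP U V W :
  reflect (forall u v, u \in U -> v \in V -> lie u v \in W)
          (lie_span U V <= W)%VS.
Proof.
apply: (iffP idP) => [sUVW u v uU vV|UVW].
  by rewrite (subvP sUVW) // memv_lie.
apply/span_subvP => _ /allpairsP[[u v] [/= uU vV ->]].
by apply: UVW; apply: vbasis_mem.
Qed.

Fixpoint lcs i : {vspace g} :=
  if i is i'.+1 then lie_span fullv (lcs i') else fullv.

(* Nilpotency index k; this forces g to be nonzero, so that k > 0. *)
Definition step_nilpotent k := lcs k = 0%VS /\ lcs k.-1 <> 0%VS.

Lemma lcsS i : (lcs i.+1 <= lcs i)%VS.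
Proof.
elim: i => [|i IH]; first exact: subvf.
apply/lie_spanP => u v uU vV; apply: memv_lie uU _; exact: subvP IH _ vV.
Qed.

Lemma lcs_le i j : (i <= j)%N -> (lcs j <= lcs i)%VS.
Proof.
move=> /subnK <-; elim: (j - i)%N => [|m IH]; first by rewrite add0n subvv.
exact: subv_trans (lcsS _) IH.
Qed.

Lemma step_nilpotent_gt0 k : step_nilpotent k -> (0 < k)%N.
Proof. by case: k => // -[]. Qed.

Lemma step_nilpotent_uniq k l :
  step_nilpotent k -> step_nilpotent l -> k = l.
Proof.
suff H i j : step_nilpotent i -> step_nilpotent j -> (i <= j)%N.
  by move=> sk sl; apply/eqP; rewrite eqn_leq !H.
move=> si [j0 _]; rewrite leqNgt; apply/negP => lji; case: (si) => _; apply.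
apply/eqP; rewrite -subv0 -j0 lcs_le // -ltnS prednK //.
exact: step_nilpotent_gt0 si.
Qed.

End LieTheory.

Section FormDef.
Variables (R : realType) (g : vectType R) (p : nat).
Implicit Types (x : 'I_p -> g) (c : ('I_p -> g) -> R^o).

Definition upd x (i : 'I_p) (v : g) : 'I_p -> g :=
  fun j => if j == i then v else x j.

Definition multilinear c := forall x i (a : R) u v,
  c (upd x i (a *: u + v)) = a * c (upd x i u) + c (upd x i v).

Definition alternating c := forall x (i j : 'I_p),
  i != j -> x i = x j -> c x = 0.

Definition is_form : {pred ('I_p -> g) -> R^o} :=
  fun c => `[< multilinear c /\ alternating c >].

(* Lambda^p g^*, as the space of alternating p-linear maps g^p -> R. *)
Record altform := Form { form_val :> ('I_p -> g) -> R^o; _ : is_form form_val }.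

HB.instance Definition _ := [isSub for form_val].
HB.instance Definition _ := [Choice of altform by <:].

Fact is_form_submod : subsemimod_closed is_form.
Proof.
split; first split.
- by apply/asboolP; split=> [x i a u v|//]; rewrite mulr0 addr0.
- move=> c d /asboolP[cm ca] /asboolP[dm da]; apply/asboolP; split.
    by move=> x i a u v; rewrite !addrfctE cm dm mulrDr addrACA.
  by move=> x i j nij eqx; rewrite addrfctE (ca _ i j) ?(da _ i j) ?addr0.
- move=> b c /asboolP[cm ca]; apply/asboolP; split.
    by move=> x i a u v; rewrite !scalrfctE cm /GRing.scale /= mulrDr mulrCA.
  by move=> x i j nij eqx; rewrite scalrfctE (ca _ i j) ?scaler0.
Qed.
HB.instance Definition _ := GRing.isSubmodClosed.Build R _ is_form is_form_submod.
HB.instance Definition _ := [SubChoice_isSubLmodule of altform by <:].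

Lemma form_multilinear (c : altform) : multilinear c.
Proof. by case: c => c /= /asboolP[]. Qed.
Lemma form_alternating (c : altform) : alternating c.
Proof. by case: c => c /= /asboolP[]. Qed.
Lemma formP (c d : altform) : c =1 d <-> c = d.
Proof. by split=> [/funext/val_inj|->]. Qed.

End FormDef.

Section SubVector.
Variables (R : fieldType) (V : lmodType R) (W : vectType R).
Variable f : {linear V -> W}.

Lemma vector_axiom_inj : injective f -> {n & Vector.axiom n V}.
Proof.
move=> f_inj.
pose P k := `[< exists v : 'I_k -> V, free [tuple f (v i) | i < k] >].
have exP : exists k, P k.
  exists 0%N; apply/asboolP; exists (fun=> 0); rewrite /free.
  by rewrite (_ : tval _ = [::]) ?span_nil ?dimv0 //; case: [tuple _ | _ < _] => -[].
have ubP k : P k -> (k <= \dim {:W})%N.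
  move=> /asboolP[v]; rewrite /free size_tuple => /eqP <-.
  exact/dimvS/subvf.
case: (ex_maxnP exP ubP) => n /asboolP/cid[v vfree] nmax.
exists n; pose X := [tuple f (v i) | i < n].
have fX x : f x \in <<X>>%VS.
  apply/negPn/negP => xX; suff: (n < n)%N by rewrite ltnn.
  apply: nmax; apply/asboolP.
  exists (fun i => if unlift ord0 i is Some j then v j else x).
  have -> : [tuple f (if unlift ord0 i is Some j then v j else x) | i < n.+1]
          = [tuple of f x :: X].
    apply: eq_from_tnth => i; rewrite tnth_mktuple.
    case: (unliftP ord0 i) => [j|] -> /=; rewrite ?tnth0 //.
    by rewrite tnthS tnth_mktuple.
  by rewrite /= free_cons xX.
have XE (i : 'I_n) : X`_i = f (v i) by rewrite -tnth_nth tnth_mktuple.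
exists (fun x => \row_i coord X i (f x)).
  by move=> a x y; apply/rowP => i; rewrite !mxE !linearP.
exists (fun r : 'rV[R]_n => \sum_i r 0 i *: v i) => [x|r].
  apply: f_inj; rewrite [RHS](coord_span (fX x)) linear_sum.
  by apply: eq_bigr => i _; rewrite linearZ /= mxE XE.
apply/rowP => i; rewrite mxE linear_sum.
rewrite (eq_bigr (fun j => r 0 j *: X`_j)) ?coord_sum_free // => j _.
by rewrite linearZ /= XE.
Qed.

End SubVector.

Section FormVector.
Variables (R : realType) (g : vectType R) (p : nat).
Implicit Types (x : 'I_p -> g) (c d : altform g p).
Local Notation n := (\dim {:g}).
Local Notation e := (vbasis {:g}).

Lemma upd_id x i : upd x i (x i) = x.
Proof. by apply/funext => j; rewrite /upd; case: eqP => // ->. Qed.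

Lemma upd_upd x i u v : upd (upd x i u) i v = upd x i v.
Proof. by apply/funext => j; rewrite /upd; case: eqP. Qed.

Lemma updC x i j u v : i != j -> upd (upd x i u) j v = upd (upd x j v) i u.
Proof.
move=> nij; apply/funext => k; rewrite /upd.
by have [-> | //] := eqVneq k j; rewrite eq_sym (negPf nij).
Qed.

Lemma upd_eq x i u : upd x i u i = u. Proof. by rewrite /upd eqxx. Qed.

Lemma upd_neq x i j u : j != i -> upd x i u j = x j.
Proof. by rewrite /upd => /negPf->. Qed.

Lemma multilinearD (c : ('I_p -> g) -> R^o) x i u v : multilinear c ->
  c (upd x i (u + v)) = c (upd x i u) + c (upd x i v).
Proof. by move=> cm; have := cm x i 1 u v; rewrite scale1r mul1r. Qed.

Lemma multilinear0 (c : ('I_p -> g) -> R^o) x i : multilinear c ->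
  c (upd x i 0) = 0.
Proof.
move=> cm; have := cm x i (-1) 0 0.
by rewrite scaler0 addr0 mulN1r addNr.
Qed.

Lemma multilinear_sum (c : ('I_p -> g) -> R^o) x i m (a : 'I_m -> R) (v : 'I_m -> g) :
  multilinear c -> 
  c (upd x i (\sum_j a j *: v j)) = \sum_j a j * c (upd x i (v j)).
Proof.
move=> cm; elim/big_rec2: _ => [|j s t _ IH]; first exact: multilinear0.
by rewrite cm IH.
Qed.

Lemma form_eq_basis c d :
  (forall f : {ffun 'I_p -> 'I_n}, c (fun i => e`_(f i)) = d (fun i => e`_(f i))) ->
  c = d.
Proof.
move=> cd; apply/formP.
suff H m : (m <= p)%N -> forall x,
    (forall i : 'I_p, (m <= i)%N -> x i \in (e : seq g)) -> c x = d x.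
  by move=> x; apply: (H p) => // i; rewrite leqNgt ltn_ord.
elim: m => [_ x xe|m IH ltmp x xe].
  have [f xf] : exists f : {ffun 'I_p -> 'I_n}, forall i, x i = e`_(f i).
    have /choice[f Hf] i : exists j : 'I_n, x i = e`_j.
      have /seq_tnthP[j ->] := xe i isT.
      have jn : (j < n)%N by rewrite -{2}(size_tuple e) ltn_ord.
      by exists (Ordinal jn); rewrite (tnth_nth 0).
    by exists (finfun f) => i; rewrite ffunE.
  by rewrite (funext xf) cd.
pose i := Ordinal ltmp.
rewrite -(upd_id x i) (coord_vbasis (memvf (x i))).
rewrite !multilinear_sum; try exact: form_multilinear.
apply: eq_bigr => j _; congr (_ * _); apply: IH; first exact: ltnW.
move=> k lemk; rewrite /upd; case: eqVneq => [_|nki].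
  by rewrite mem_nth // size_tuple.
by apply: xe; rewrite ltn_neqAle lemk andbT eq_sym.
Qed.

Definition form_coord c : {ffun {ffun 'I_p -> 'I_n} -> R^o} :=
  [ffun f : {ffun 'I_p -> 'I_n} => c (fun i => e`_(f i))].

Fact form_coord_linear : linear form_coord.
Proof. by move=> a c d; apply/ffunP => f; rewrite !ffunE. Qed.
HB.instance Definition _ :=
  GRing.isLinear.Build R (altform g p) _ _ form_coord form_coord_linear.

Lemma form_coord_inj : injective form_coord.
Proof.
move=> c d cd; apply: form_eq_basis => f.
by have := congr1 (fun h : {ffun _} => h f) cd; rewrite !ffunE.
Qed.

HB.instance Definition _ := Lmodule_hasFinDim.Build R (altform g p)
  (projT2 (vector_axiom_inj form_coord_inj)).

End FormVector.

Section Alternating.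
Variables (R : realType) (g : vectType R) (p : nat).
Variable c : ('I_p -> g) -> R^o.
Hypothesis cm : multilinear c.

Lemma adjacent_alternating :
  (forall x (i j : 'I_p), j = i.+1 :> nat -> x i = x j -> c x = 0) ->
  alternating c.
Proof.
move=> c0.
have swap x (i j : 'I_p) : j = i.+1 :> nat ->
    c x = - c (upd (upd x i (x j)) j (x i)).
  move=> ji; have nij : i != j by rewrite -val_eqE /= ji neq_ltn leqnn.
  have := c0 (upd (upd x i (x i + x j)) j (x i + x j)) i j ji.
  rewrite upd_eq {1}/upd (negPf nij) upd_eq => /(_ erefl).
  rewrite (multilinearD _ _ _ _ cm) ![upd (upd x i _) j _]updC //.
  rewrite !(multilinearD _ _ _ _ cm).
  rewrite (c0 (upd (upd x j (x i)) i (x i)) i j ji); last first.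
    by rewrite upd_eq {1}/upd eq_sym (negPf nij) upd_eq.
  rewrite (c0 (upd (upd x j (x j)) i (x j)) i j ji); last first.
    by rewrite upd_eq {1}/upd eq_sym (negPf nij) upd_eq.
  by rewrite add0r addr0 !upd_id => /eqP; rewrite addrC addr_eq0 => /eqP.
suff H m : forall x (i j : 'I_p), j = (i + m.+1)%N :> nat -> x i = x j -> c x = 0.
  move=> x i j; wlog ltij : i j / (i < j)%N => [W|_ xij].
    case: (ltngtP i j) => [/W//|ltji|/val_inj ->]; last by rewrite eqxx.
    by rewrite eq_sym => nij /esym; apply: W.
  by apply: (H (j - i).-1 x i j) => //; rewrite prednK ?subn_gt0 // subnKC // ltnW.
elim: m => [|m IH] x i j ji xij; first by apply: (c0 x i j); rewrite // ji addn1.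
have ltkp : (i + m.+1 < p)%N.
  by apply: ltn_trans (ltn_ord j); rewrite ji ltn_add2l.
pose k := Ordinal ltkp.
have jk : j = k.+1 :> nat by rewrite ji addnS.
rewrite (swap x k j jk) (IH _ i k) ?oppr0 //.
have nik : i != k by rewrite -val_eqE /= -{1}[val i]addn0 eqn_add2l.
have nij : i != j by rewrite -val_eqE /= ji -{1}[val i]addn0 eqn_add2l.
have nkj : k != j by rewrite -val_eqE /= ji eqn_add2l neq_ltn leqnn.
by rewrite /upd (negPf nij) (negPf nik) (negPf nkj) eqxx.
Qed.

End Alternating.

Section Differential.
Variables (R : realType) (g : lieAlgType R).

Definition args p (s : seq g) : 'I_p -> g := fun l => nth 0 s l.

Section Degree.
Variable p : nat.
Implicit Types (x : 'I_p.+1 -> g) (i j l m a b : 'I_p.+1).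

Definition others i j : seq 'I_p.+1 :=
  [seq m <- enum 'I_p.+1 | (m != i) && (m != j)].

Definition ce_args x i j : 'I_p -> g :=
  args (lie (x i) (x j) :: [seq x m | m <- others i j]).

(* With indices starting at 0, the sign (-1)^(i+j-1) of the usual formula
   becomes (-1)^(i+j+1). *)
Definition ce (c : ('I_p -> g) -> R^o) (x : 'I_p.+1 -> g) : R^o :=
  \sum_(i < p.+1) \sum_(j < p.+1 | (i < j)%N) (-1) ^+ (i + j).+1 * c (ce_args x i j).

Lemma size_others i j : i != j -> size (others i j) = p.-1.
Proof.
move=> nij; have := cardC (pred2 i j); rewrite card2 nij card_ord.
have -> : #|predC (pred2 i j)| = size (others i j).
  have /card_uniqP <- : uniq (others i j) by rewrite filter_uniq ?enum_uniq.
  by apply: eq_card => m; rewrite !inE mem_filter mem_enum negb_or andbT.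
by lia.
Qed.

Lemma others_pos i j m : i != j -> m != i -> m != j ->
  ((index m (others i j)).+1 < p)%N.
Proof.
move=> nij mi mj; have: (index m (others i j) < p.-1)%N.
  by rewrite -(size_others nij) index_mem mem_filter mi mj mem_enum.
by lia.
Qed.

Lemma ltn_p_gt0 i j : (i < j)%N -> (0 < p)%N.
Proof. by have := ltn_ord j; lia. Qed.

Lemma map_upd_notin x l v (s : seq 'I_p.+1) : l \notin s ->
  [seq upd x l v m | m <- s] = [seq x m | m <- s].
Proof.
move=> ls; apply/eq_in_map => m ms; rewrite /upd; case: eqP => // ml.
by rewrite ml (negPf ls) in ms.
Qed.

Lemma ce_args_upd x l i j : (i < j)%N -> exists k (h : g -> g),
  (forall (a : R) u v, h (a *: u + v) = a *: h u + h v) /\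
  (forall v, ce_args (upd x l v) i j = upd (ce_args x i j) k (h v)).
Proof.
move=> ltij; have nij : i != j by rewrite -val_eqE neq_ltn ltij.
pose k0 := Ordinal (ltn_p_gt0 ltij).
have k0E ltq : Ordinal (ltq : (0 < p)%N) = k0 by apply: val_inj.
have [->|nli] := eqVneq l i.
  exists k0, (fun v => lie v (x j)); split=> [a u v|v]; first exact: lieDl.
  apply/funext => -[[|q] ltq]; last first.
    by rewrite upd_neq // /ce_args /args /= map_upd_notin // mem_filter eqxx.
  by rewrite k0E upd_eq /ce_args /args /= upd_eq upd_neq // eq_sym.
have [->|nlj] := eqVneq l j.
  exists k0, (fun v => lie (x i) v); split=> [a u v|v]; first exact: lieDr.
  apply/funext => -[[|q] ltq]; last first.
    by rewrite upd_neq // /ce_args /args /= map_upd_notin // mem_filter eqxx andbF.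
  by rewrite k0E upd_eq /ce_args /args /= upd_eq upd_neq.
exists (Ordinal (others_pos nij nli nlj)), id; split=> // v.
apply/funext => -[[|q] ltq].
  by rewrite upd_neq // /ce_args /args /= !upd_neq // eq_sym.
have ltqs : (q < size (others i j))%N.
  by rewrite size_others //; lia.
rewrite /upd -val_eqE /ce_args /args /= !(nth_map l) // eqSS.
congr (if _ then _ else _).
have ls : l \in others i j by rewrite mem_filter nli nlj mem_enum.
rewrite -{2}(nth_index l ls) nth_uniq ?index_mem //.
by rewrite filter_uniq // enum_uniq.
Qed.

Lemma ce_multilinear (c : altform g p) : multilinear (ce c).
Proof.
move=> x l a u v; rewrite /ce mulr_sumr -big_split; apply: eq_bigr => i _.
rewrite /= mulr_sumr -big_split; apply: eq_bigr => j ltij /=.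
have [k [h [hl hE]]] := ce_args_upd x l ltij.
by rewrite !hE hl form_multilinear mulrDr mulrCA.
Qed.

Lemma map_others_adj x a b r : b = a.+1 :> nat -> x a = x b ->
  r != a -> r != b -> [seq x m | m <- others a r] = [seq x m | m <- others b r].
Proof.
move=> ba xab nra nrb.
have nab : a != b by rewrite -val_eqE /= ba neq_ltn leqnn.
have enumE : enum 'I_p.+1 =
    take a (enum 'I_p.+1) ++ [:: a, b & drop b.+1 (enum 'I_p.+1)].
  rewrite -{1}(cat_take_drop a (enum 'I_p.+1)) (drop_nth a) ?size_enum_ord //.
  rewrite -ba (drop_nth a (n := b)) ?size_enum_ord //.
  by rewrite !nth_ord_enum.
have := enum_uniq 'I_p.+1; rewrite /others enumE.
set s1 := take _ _; set s2 := drop _ _.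
rewrite cat_uniq /= !inE !negb_or => /and5P[_ /and3P[as1 bs1 _] /andP[_ as2] bs2 _].
rewrite !filter_cat !map_cat /= !eqxx nab (eq_sym b) nab.
rewrite (eq_sym a r) nra (eq_sym b r) nrb /= xab.
have E (s : seq 'I_p.+1) : a \notin s -> b \notin s ->
    [seq m <- s | (m != a) && (m != r)] = [seq m <- s | (m != b) && (m != r)].
  move=> na nb; apply: eq_in_filter => m ms; congr (_ && _).
  by rewrite (memPn na) ?(memPn nb).
by rewrite !E.
Qed.

Lemma othersC i j : others i j = others j i.
Proof. by apply: eq_filter => m; rewrite andbC. Qed.

Lemma ce_alternating (c : altform g p) : alternating (ce c).
Proof.
apply: adjacent_alternating; first exact: ce_multilinear.
move=> x a b ba xab.
have nab : a != b by rewrite -val_eqE /= ba neq_ltn leqnn.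
have ltab : (a < b)%N by rewrite ba.
rewrite /ce pair_big_dep /=; set T := BIG_F.
pose t := tperm a b; pose h (u : 'I_p.+1 * 'I_p.+1) := (t u.1, t u.2).
have hK : involutive h by move=> [i j]; rewrite /h /= !tpermK.
rewrite (bigD1 (a, b)) //= {1}/T /=.
have -> : c (ce_args x a b) = 0.
  pose k0 := Ordinal (ltn_p_gt0 ltab).
  rewrite -(upd_id (ce_args x a b) k0) {2}/ce_args /args /= xab liexx.
  exact/multilinear0/form_multilinear.
rewrite mulr0 add0r.
set S := (LHS); suff : S = - S.
  by move/eqP; rewrite -addr_eq0 -mulr2n mulrn_eq0 => /eqP.
have xt m : x (t m) = x m.
  by rewrite /t; case: tpermP => [->|->|].
pose s (k : nat) := if k == a then a.+1 else if k == a.+1 then a : nat else k.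
have tE m : val (t m) = s (val m).
  rewrite /t /s; case: tpermP => [->|->|/eqP na /eqP nb]; rewrite /= ?ba ?eqxx //.
    by rewrite ifF //; lia.
  by rewrite -ba !(inj_eq val_inj) (negPf na) (negPf nb).
have sE (k l : nat) :
    ((s k < s l) && ~~ ((s k == a) && (s l == a.+1)))%N =
    ((k < l) && ~~ ((k == a) && (l == a.+1)))%N.
  by rewrite /s; do !case: ifP => ?; lia.
have hE u : ((h u).1 < (h u).2)%N && (h u != (a, b)) =
    (u.1 < u.2)%N && (u != (a, b)).
  case: u => i j; rewrite /h !xpair_eqE -!val_eqE.
  by have := sE (val i) (val j); rewrite -!tE -ba.
rewrite {1}/S (reindex_inj (inv_inj hK)) -sumrN; apply: eq_big => [u|[i j]].
  exact: hE.
rewrite hE => /= /andP[ltij nijab].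
have nij : i != j by rewrite -val_eqE neq_ltn ltij.
have argsE r : r != a -> r != b -> ce_args x b r = ce_args x a r /\
    ce_args x r b = ce_args x r a.
  move=> nra nrb; rewrite /ce_args -xab -!(othersC _ r).
  by rewrite (map_others_adj ba xab nra nrb).
rewrite /T /h /= /t; case: tpermP => [ia|ib|/eqP nia /eqP nib].
- case: tpermP => [ja|jb|/eqP nja /eqP njb].
  + by rewrite ia ja eqxx in nij.
  + by rewrite ia jb eqxx in nijab.
  by rewrite (argsE _ nja njb).1 ia ba addSn exprS mulN1r mulNr.
- case: tpermP => [ja|jb|/eqP nja /eqP njb].
  + by move: ltij; rewrite ib ja ba; lia.
  + by rewrite ib jb eqxx in nij.
  by rewrite -(argsE _ nja njb).1 ib ba addSn [in RHS]exprS mulN1r mulNr opprK.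
case: tpermP => [ja|jb|/eqP nja /eqP njb].
- by rewrite (argsE _ nia nib).2 ja ba addnS exprS mulN1r mulNr.
- by rewrite -(argsE _ nia nib).2 jb ba addnS [in RHS]exprS mulN1r mulNr opprK.
suff -> : c (ce_args x i j) = 0 by rewrite !mulr0 oppr0.
have [nai nbi naj nbj] : [/\ a != i, b != i, a != j & b != j].
  by rewrite ![a == _]eq_sym ![b == _]eq_sym.
have ain : a \in others i j by rewrite mem_filter nai naj mem_enum.
have bin : b \in others i j by rewrite mem_filter nbi nbj mem_enum.
apply: (form_alternating _ (i := Ordinal (others_pos nij nai naj))
  (j := Ordinal (others_pos nij nbi nbj))).
  rewrite -val_eqE /= eqSS; apply: contra_neq nab => eqab.
  by rewrite -(nth_index a ain) eqab nth_index.
by rewrite /ce_args /args /= !(nth_map a) ?index_mem // !nth_index.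
Qed.

Fact ce_is_form (c : altform g p) : is_form (ce c).
Proof.
by apply/asboolP; split; [apply: ce_multilinear | apply: ce_alternating].
Qed.

Definition ce_form (c : altform g p) : altform g p.+1 := Form (ce_is_form c).

Fact ce_form_linear : linear ce_form.
Proof.
move=> a c e; apply/formP => x; rewrite -[RHS]/(a * ce c x + ce e x) /= /ce.
rewrite mulr_sumr -big_split; apply: eq_bigr => i _ /=.
rewrite mulr_sumr -big_split; apply: eq_bigr => j _ /=.
by rewrite mulrCA -mulrDr.
Qed.
HB.instance Definition _ :=
  GRing.isLinear.Build R (altform g p) (altform g p.+1) _ ce_form ce_form_linear.

Definition dCE : 'Hom(altform g p, altform g p.+1) := linfun ce_form.

Lemma dCE_E (c : altform g p) x : dCE c x =
  \sum_(i < p.+1) \sum_(j < p.+1 | (i < j)%N)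
    (-1) ^+ (i + j).+1 * c (ce_args x i j).
Proof. by rewrite lfunE. Qed.

End Degree.
End Differential.

Section Exterior.
Variables (R : realType) (g : vectType R) (p : nat).
Implicit Types (W : {vspace altform g 1}).

Definition wedge_fun (al : 'I_p -> altform g 1) (x : 'I_p -> g) : R^o :=
  \det (\matrix_(j, i) al i (fun=> x j)).

Fact wedge_is_form al : is_form (wedge_fun al).
Proof.
apply/asboolP; split=> [x k a u v|x i j nij xij]; last first.
  by apply: (determinant_alternate nij) => k; rewrite !mxE xij.
have updE w : (fun=> w) = upd (fun=> 0 : g) (ord0 : 'I_1) w.
  by apply/funext => i; rewrite /upd ord1.
rewrite /wedge_fun -[X in _ = _ + X]mul1r; apply: (determinant_multilinear (i0 := k)).
- apply/rowP => i; rewrite !mxE !upd_eq [in LHS]updE form_multilinear -!updE.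
  by rewrite mul1r.
- by apply/matrixP => i l; rewrite !mxE !upd_neq // eq_sym neq_lift.
- by apply/matrixP => i l; rewrite !mxE !upd_neq // eq_sym neq_lift.
Qed.

(* al_1 /\ ... /\ al_p *)
Definition wedge al : altform g p := Form (wedge_is_form al).

(* Lambda^p W, spanned by the products al_1 /\ ... /\ al_p with al_i in W; it
   is enough to take the al_i in a basis of W, see memv_wedge. *)
Definition ext W : {vspace altform g p} :=
  <<[seq wedge (fun i => (vbasis W)`_(f i)) | f : {ffun 'I_p -> 'I_(\dim W)}]>>%VS.

Lemma memv_wedge W al : (forall i, al i \in W) -> wedge al \in ext W.
Proof.
move=> alW; pose a i k := coord (vbasis W) k (al i).
have -> : wedge al = \sum_(f : {ffun 'I_p -> 'I_(\dim W)})
    (\prod_i a i (f i)) *: wedge (fun i => (vbasis W)`_(f i)).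
  apply/formP => x.
  have sumE m (I : finType) (c : I -> altform g m) y :
      (\sum_k c k) y = \sum_k (c k y).
    by apply: (big_morph (fun c : altform g m => c y)).
  rewrite sumE /= /wedge_fun -det_tr.
  under eq_bigr => f _ do rewrite -[_ x]/(_ * \det _) -det_tr.
  rewrite /determinant; under eq_bigr => f _ do rewrite mulr_sumr.
  rewrite exchange_big; apply: eq_bigr => s _ /=.
  under [RHS]eq_bigr => f _ do rewrite mulrCA -big_split /=.
  rewrite -mulr_sumr; congr (_ * _).
  under [RHS]eq_bigr => f _ do under eq_bigr => i _ do rewrite !mxE.
  rewrite -(bigA_distr_bigA (fun i k => a i k * (vbasis W)`_k (fun=> x (s i)))).
  apply: eq_bigr => i _; rewrite !mxE {1}(coord_vbasis (alW i)) sumE.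
  by apply: eq_bigr.
apply: rpred_sum => f _; apply: rpredZ; apply: memv_span.
by apply/mapP; exists f; rewrite ?mem_enum.
Qed.

End Exterior.

(* The quotient of A by A :&: B, as the image of A under a projection with
   kernel A :&: B, see quotvP; A :\: B is a complement of A :&: B in A. *)
Section Quotient.
Variables (K : fieldType) (vT : vectType K).
Implicit Types A B : {vspace vT}.

Definition quotv A B : {vspace vT} := (A :\: B)%VS.

Lemma quotvP A B : exists2 f : 'End(vT),
  (f @: A)%VS = quotv A B & (A :&: lker f)%VS = (A :&: B)%VS.
Proof.
exists (addv_pi1 A B).
  apply/eqP; rewrite eqEsubv; apply/andP; split.
    by apply/subvP => _ /memv_imgP[u _ ->]; apply: memv_pi.
  apply/subvP => u uD; rewrite -[u](daddv_pi_id (capv_diff A B) uD).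
  by rewrite memv_img // (subvP (diffvSl A B)).
apply/vspaceP => u; rewrite !memv_cap memv_ker.
have [uA /=|//] := boolP (u \in A).
have := addv_pi1_pi2 (subvP (addvSl A B) _ uA).
have [uB|uB] := boolP (u \in B); last first.
  move=> uE; apply/negbTE; apply: contra uB => /eqP u0.
  by rewrite -uE u0 add0r memv_pi2.
by rewrite (addv_pi2_id _ uB) => /(canRL (addrK _)) ->; rewrite subrr eqxx.
Qed.

End Quotient.

Section Spectral.
Variables (R : realType) (g : lieAlgType R).

(* g^* is Lambda^1 g^* = altform g 1. *)
Fixpoint Vfilt i : {vspace altform g 1} :=
  if i is i'.+1 then (dCE g 1 @^-1: ext 2 (Vfilt i'))%VS else 0%VS.

Definition cocycles m (W : {vspace altform g 1}) : {vspace altform g m} :=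
  (lker (dCE g m) :&: ext m W)%VS.

(* d {x \in Lambda^(m-1) g^* | d x \in Lambda^m W} *)
Definition coboundaries m (W : {vspace altform g 1}) : {vspace altform g m} :=
  match m with
  | 0 => 0%VS
  | m'.+1 => (dCE g m' @: (dCE g m' @^-1: ext m'.+1 W))%VS
  end.

(* The limit term E_oo^{p,q} of the filtration F^p = Lambda^* V_{k-p}, for g of
   nilpotency index k: cocycles in F^p modulo coboundaries and cocycles in
   F^{p+1}. The denominator is contained in the numerator, as d \o d = 0. *)
Definition Einf k p q : {vspace altform g (p + q)} :=
  quotv (cocycles (p + q) (Vfilt (k - p)))
        (coboundaries (p + q) (Vfilt (k - p)) + cocycles (p + q) (Vfilt (k - p - 1))).

Definition nondegenerate (w : altform g 2) :=
  forall x, (forall y, w (args [:: x; y]) = 0) -> x = 0.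

Definition symplectic (w : altform g 2) := dCE g 2 w = 0 /\ nondegenerate w.

End Spectral.

Section LowDegree.
Variables (R : realType) (g : lieAlgType R).
Implicit Types (x y z u v : g).

Lemma d1E (al : altform g 1) x y :
  dCE g 1 al (args [:: x; y]) = al (args [:: lie x y]).
Proof.
rewrite dCE_E; under eq_bigr do rewrite big_mkcond.
rewrite !big_ord_recl !big_ord0 /= !addr0 !add0r /bump /= expr2 mulrNN !mul1r.
by congr (al _); apply/funext => -[[|i] lti].
Qed.

Lemma d2E (w : altform g 2) x y z :
  dCE g 2 w (args [:: x; y; z]) = w (args [:: lie x y; z])
    - w (args [:: lie x z; y]) + w (args [:: lie y z; x]).
Proof.
have oE (i j k : 'I_3) (s : seq g) : [/\ k != i, k != j & i != j] ->
    ce_args (args s) i j = args [:: lie s`_i s`_j; s`_k].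
  move=> [ki kj ij]; rewrite /ce_args /args /=.
  have -> : others i j = [:: k].
    apply: perm_small_eq => //.
    apply: uniq_perm => // [|m]; first by rewrite /others filter_uniq ?enum_uniq.
    rewrite mem_filter mem_enum !inE andbT; apply/idP/eqP => [|->]; last by rewrite ki.
    move: ki kj ij; rewrite -!val_eqE /= => ki kj ij /andP[mi mj]; apply: val_inj => /=.
    by move: (ltn_ord i) (ltn_ord j) (ltn_ord k) (ltn_ord m); lia.
  by [].
rewrite dCE_E; under eq_bigr do rewrite big_mkcond.
rewrite !big_ord_recl !big_ord0 /= !(addr0, add0r) /bump /=.
rewrite (oE ord0 (lift ord0 ord0) (lift ord0 (lift ord0 ord0))) //.
rewrite (oE ord0 (lift ord0 (lift ord0 ord0)) (lift ord0 ord0)) //.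
rewrite (oE (lift ord0 ord0) (lift ord0 (lift ord0 ord0)) ord0) //=.
by rewrite /bump /= !exprS expr0 !(mulrN1, mulN1r, mulrNN, mulr1, mul1r, opprK, mulNr).
Qed.

Lemma form2Dl (w : altform g 2) a x y z :
  w (args [:: a *: x + y; z]) = a * w (args [:: x; z]) + w (args [:: y; z]).
Proof.
have E u : args [:: u; z] = upd (args [:: 0; z]) (ord0 : 'I_2) u.
  by apply/funext => -[[|[|]]].
by rewrite (E (_ + _)) (E x) (E y) form_multilinear.
Qed.

Lemma form2Dr (w : altform g 2) a x y z :
  w (args [:: z; a *: x + y]) = a * w (args [:: z; x]) + w (args [:: z; y]).
Proof.
have E u : args [:: z; u] = upd (args [:: z; 0]) (ord_max : 'I_2) u.
  by apply/funext => -[[|[|]]].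
by rewrite (E (_ + _)) (E x) (E y) form_multilinear.
Qed.

Lemma form20l (w : altform g 2) x : w (args [:: 0; x]) = 0.
Proof.
by have := form2Dl w (-1) 0 0 x; rewrite scaler0 addr0 mulN1r addNr.
Qed.

Lemma form2xx (w : altform g 2) x : w (args [:: x; x]) = 0.
Proof. exact: (form_alternating _ (i := ord0) (j := ord_max : 'I_2)). Qed.

Lemma form2C (w : altform g 2) x y : w (args [:: y; x]) = - w (args [:: x; y]).
Proof.
have := form2xx w (1 *: x + y); rewrite form2Dl !form2Dr !form2xx.
by rewrite !mul1r add0r addr0 => /eqP; rewrite addrC addr_eq0 => /eqP.
Qed.

End LowDegree.

Section CentralExtension.
Variables (R : realType) (g : lieAlgType R) (w : altform g 2).

(* The underlying space of g (+) R z, with z = (0, 1); the closedness of w is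
   an argument because the Jacobi identity of the bracket depends on it. *)
Definition central_ext of dCE g 2 w = 0 : Type := (g * R^o)%type.

Variable dw0 : dCE g 2 w = 0.
HB.instance Definition _ := Vector.copy (central_ext dw0) (g * R^o)%type.

Definition cext_lie (u v : central_ext dw0) : central_ext dw0 :=
  (lie u.1 v.1, w (args [:: u.1; v.1])).

Fact cext_lieDl (a : R) u v t :
  cext_lie (a *: u + v) t = a *: cext_lie u t + cext_lie v t.
Proof. by rewrite /cext_lie /= lieDl form2Dl. Qed.

Fact cext_lieDr (a : R) u v t :
  cext_lie u (a *: v + t) = a *: cext_lie u v + cext_lie u t.
Proof. by rewrite /cext_lie /= lieDr form2Dr. Qed.

Fact cext_liexx u : cext_lie u u = 0.
Proof. by rewrite /cext_lie liexx form2xx. Qed.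

Fact cext_jacobi u v t :
  cext_lie u (cext_lie v t) + cext_lie v (cext_lie t u)
    + cext_lie t (cext_lie u v) = 0.
Proof.
rewrite /cext_lie; congr (_, _) => /=; first exact: jacobi.
have := d2E w u.1 v.1 t.1; rewrite dw0 => /esym /= H.
rewrite (form2C w (lie v.1 t.1)) (form2C w (lie t.1 u.1)) (form2C w (lie u.1 v.1)).
rewrite (lieC u.1 t.1) -[- lie u.1 t.1]scaleN1r -[-1 *: _]addr0 form2Dl form20l.
apply: oppr_inj; rewrite oppr0 -[RHS]H.
by rewrite mulN1r addr0 opprK !opprD !opprK [LHS]addrC addrA [RHS]addrAC.
Qed.

HB.instance Definition _ := Vector_isLie.Build R (central_ext dw0)
  cext_lieDl cext_lieDr cext_liexx cext_jacobi.

Lemma lie_cextE (u v : central_ext dw0) :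
  lie u v = (lie u.1 v.1, w (args [:: u.1; v.1])).
Proof. by []. Qed.

End CentralExtension.

(* Main.v *)
From HB Require Import structures.
Require Import Defs.
From mathcomp Require Import all_boot all_order all_algebra.
From mathcomp Require Import all_classical reals.

Set Implicit Arguments.
Unset Strict Implicit.
Unset Printing Implicit Defensive.

Import GRing.Theory Num.Theory.
Local Open Scope ring_scope.

(** Write [E] for the extension, [P] for the pullback of forms along [E -> n], and
    [k] for the index of [n].  The [i]-th term of the lower central series of [E]
    is the preimage of that of [n] for [i <= k]: the [k]-th one is the line of [z],
    because [w] is nondegenerate.  Hence [E] has index [k + 1], and since [V_i] is
    the annihilator of the [i]-th term, the cocycles of [E] in [Lambda^2 V_i] are
    the pullbacks of those of [n].  As [d] of the coordinate along [z] is [P w],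
    and exact forms [d al] lie in [Lambda^2 V_(k-1)], both groups become quotients
    of [Z^2(n)]: by [Z^2(V_(k-1))] for [n], and by [R w + Z^2(V_(k-1))] for [E].
    Finally [w] is not in [Lambda^2 V_(k-1)], whose forms have the nonzero last
    term of the series in their radical. *)

(** * Forms of degree at most three, and the exterior square of an annihilator *)

Section Forms.
Variables (R : realType) (g : lieAlgType R).

Lemma form_sumE p (I : finType) (c : I -> altform g p) x :
  (\sum_i c i) x = \sum_i c i x.
Proof. by apply: (big_morph (fun c : altform g p => c x)). Qed.

Definition form1_fun (al : altform g 1) (x : g) : R^o := al (args [:: x]).

Fact form1_fun_linear al : linear (form1_fun al).
Proof.
move=> a x y; rewrite /form1_fun.
have E (u : g) : args [:: u] = upd (args [:: 0]) (ord0 : 'I_1) u.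
  by apply/funext => -[[|]].
by rewrite (E (_ + _)) (E x) (E y) form_multilinear.
Qed.
HB.instance Definition _ al :=
  GRing.isLinear.Build R g R^o _ (form1_fun al) (form1_fun_linear al).

Lemma form1_args (al : altform g 1) (x : 'I_1 -> g) : al x = al (args [:: x ord0]).
Proof. by congr (al _); apply/funext => i; rewrite ord1. Qed.

Lemma form2_args (b : altform g 2) (x : 'I_2 -> g) :
  b x = b (args [:: x ord0; x ord_max]).
Proof.
congr (b _); apply/funext => -[[|[|//]] lti]; congr (x _); exact: val_inj.
Qed.

Lemma form1_eq (al be : altform g 1) :
  (forall x, al (args [:: x]) = be (args [:: x])) -> al = be.
Proof. by move=> E; apply/formP => x; rewrite form1_args E -form1_args. Qed.

Lemma form2_eq (b c : altform g 2) :
  (forall x y, b (args [:: x; y]) = c (args [:: x; y])) -> b = c.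
Proof. by move=> E; apply/formP => x; rewrite form2_args E -form2_args. Qed.

Lemma form3_eq (b c : altform g 3) :
  (forall x y z, b (args [:: x; y; z]) = c (args [:: x; y; z])) -> b = c.
Proof.
move=> E; apply/formP => x.
suff -> : x = args [:: x ord0; x (inord 1); x ord_max] by [].
by apply/funext => -[[|[|[|//]]] lti]; congr (x _); apply: val_inj; rewrite //= inordK.
Qed.

Fact hom_is_form (f : 'Hom(g, R^o)) : is_form (fun x : 'I_1 -> g => f (x ord0)).
Proof.
apply/asboolP; split=> [x i a u v|x i j]; last by rewrite !ord1 eqxx.
by rewrite !ord1 !upd_eq linearP.
Qed.

Definition hom_form f : altform g 1 := Form (hom_is_form f).

Lemma wedge2E (al : 'I_2 -> altform g 1) x y :
  wedge al (args [:: x; y]) =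
    al ord0 (args [:: x]) * al ord_max (args [:: y]) -
    al ord_max (args [:: x]) * al ord0 (args [:: y]).
Proof.
rewrite /= /wedge_fun (expand_det_row _ ord0) !big_ord_recl big_ord0 addr0.
rewrite /cofactor !det_mx11 !mxE /= expr0 mul1r expr1 mulN1r mulrN.
have E i u : al i (fun=> u) = al i (args [:: u]) by rewrite form1_args.
rewrite !E.
have -> : lift (ord0 : 'I_2) ord0 = ord_max by apply: val_inj.
by have -> : lift (ord_max : 'I_2) ord0 = ord0 by apply: val_inj.
Qed.

Lemma form2_suml (b : altform g 2) m (a : 'I_m -> R) (v : 'I_m -> g) y :
  b (args [:: \sum_i a i *: v i; y]) = \sum_i a i * b (args [:: v i; y]).
Proof.
elim/big_rec2: _ => [|i s t _ IH]; first exact: form20l.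
by rewrite form2Dl IH.
Qed.

Lemma form2_sumr (b : altform g 2) m (a : 'I_m -> R) (v : 'I_m -> g) x :
  b (args [:: x; \sum_i a i *: v i]) = \sum_i a i * b (args [:: x; v i]).
Proof.
rewrite form2C form2_suml -sumrN; apply: eq_bigr => i _.
by rewrite form2C mulrN opprK.
Qed.

Definition is_annihilator (U : {vspace g}) (W : {vspace altform g 1}) :=
  forall al : altform g 1, reflect (forall x, x \in U -> al (args [:: x]) = 0) (al \in W).

(** A product of two elements of [W] vanishes as soon as one argument lies in [U]. Conversely, a
    form with [U] in its radical depends only on the components along the complement [U^C]; the
    coordinates along that complement, extended by zero on [U], lie in [W], and [b] expands in their
    products. *)
Lemma ext2P U W : is_annihilator U W -> forall b : altform g 2,
  reflect (forall x y, x \in U -> b (args [:: x; y]) = 0) (b \in ext 2 W).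
Proof.
move=> annW b; apply: (iffP idP) => [bW x y xU | b0].
  rewrite (coord_span bW) form_sumE big1 // => i _.
  set c := (X in _ *: X).
  suff c0 : c (args [:: x; y]) = 0 by rewrite -[LHS]/(_ * c _) c0 mulr0.
  have /mapP[f _ ->] : c \in [seq wedge (fun i => (vbasis W)`_(f i))
      | f : {ffun 'I_2 -> 'I_(\dim W)}].
    by rewrite mem_nth ?size_tuple.
  rewrite wedge2E.
  have W0 j : ((vbasis W)`_(f j) : altform g 1) (args [:: x]) = 0.
    by apply/annW: xU; rewrite vbasis_mem // mem_nth // size_tuple.
  by rewrite !W0 !mul0r subrr.
pose e := vbasis U^C.
pose r x := x - projv U x.
have rE x : r x = \sum_i coord e i (r x) *: e`_i.
  by apply: coord_vbasis; apply: memv_projC.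
pose f i : 'Hom(g, R^o) := (linfun (coord e i : g -> R^o) \o (\1 - projv U))%VF.
have fE i x : f i x = coord e i (r x).
  by rewrite /f comp_lfunE !lfun_simp.
have fW i : hom_form (f i) \in W.
  by apply/annW => x xU; rewrite /= fE /r projv_id // subrr linear0.
have br x y : b (args [:: x; y]) = b (args [:: r x; y]).
  have E : x = 1 *: projv U x + r x by rewrite scale1r addrC subrK.
  by rewrite {1}E form2Dl (b0 (projv U x)) ?memv_proj // mulr0 add0r.
have bE x y : b (args [:: x; y]) =
    \sum_i \sum_j f i x * f j y * b (args [:: e`_i; e`_j]).
  rewrite br form2C br -form2C (rE x) form2_suml; apply: eq_bigr => i _.
  rewrite (rE y) form2_sumr mulr_sumr; apply: eq_bigr => j _.
  by rewrite !fE mulrA.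
(* The sum runs over all pairs, not only over [i < j], so each product is met twice: hence the
   factor [2^-1]. *)
have -> : b = \sum_(i < \dim U^C) \sum_(j < \dim U^C) (2^-1 * b (args [:: e`_i; e`_j])) *:
    wedge (fun k : 'I_2 => hom_form (f (if k == ord0 then i else j))).
  apply: form2_eq => x y; rewrite form_sumE.
  under eq_bigr => i _ do rewrite form_sumE.
  have -> : b (args [:: x; y]) = 2^-1 * (b (args [:: x; y]) - b (args [:: y; x])).
    by rewrite (form2C b x) opprK -mulr2n -(mulr_natl (b _ : R)) mulKf ?pnatr_eq0.
  rewrite !bE -sumrB mulr_sumr; apply: eq_bigr => i _.
  rewrite -sumrB mulr_sumr; apply: eq_bigr => j _.
  rewrite -[RHS]/(_ * _ * wedge _ _) wedge2E /= -mulrBl -[RHS]mulrA; congr (_ * _).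
  rewrite mulrC; congr (_ * _).
  by rewrite (mulrC (f i y)).
by apply: rpred_sum => i _; apply: rpred_sum => j _; apply/rpredZ/memv_wedge.
Qed.

End Forms.

(** * The filtration as annihilators of the lower central series, and the group of [n] *)

Section Filtration.
Variables (R : realType) (g : lieAlgType R).

Lemma form1N (al : altform g 1) x : al (args [:: - x]) = - al (args [:: x]).
Proof. exact: (linearN (form1_fun al)). Qed.

Lemma lcsE i : lcs g i.+1 = lie_span fullv (lcs g i).
Proof. by []. Qed.

Lemma dCE_dCE1 (al : altform g 1) : dCE g 2 (dCE g 1 al) = 0.
Proof.
apply: form3_eq => x y z; rewrite d2E !d1E.
have E : lie (lie x y) z - lie (lie x z) y + lie (lie y z) x = 0.
  apply: oppr_inj; rewrite oppr0 -(jacobi x y z).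
  rewrite (lieC (lie x y) z) (lieC (lie y z) x) (lieC (lie z x) y) (lieC x z).
  rewrite -[- lie x z]scaleN1r lieZl scaleN1r !opprD !opprK.
  by rewrite [RHS]addrC addrA addrAC.
by have := congr1 (form1_fun al) E; rewrite linearD linearB linear0.
Qed.

(** By induction: since [dCE g 1 al] sends [x, y] to the value of [al] at [lie x y], [ext2P] turns
    membership of this form in the exterior square of [Vfilt g i] into the vanishing of [al] on
    brackets with [lcs g i]. *)
Lemma Vfilt_annihilator i : is_annihilator (lcs g i) (Vfilt g i).
Proof.
elim: i => [|i IH] al.
  rewrite memv0; apply: (iffP eqP) => [-> // | al0].
  by apply: form1_eq => x; rewrite al0 ?memvf.
rewrite /= -memv_preim; apply: (iffP (ext2P IH _)) => [al0 x xS | al0 x y xi].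
  pose f : 'Hom(g, R^o) := linfun (form1_fun al).
  have fE u : f u = al (args [:: u]) by rewrite lfunE.
  suff /subvP/(_ x xS) : (lcs g i.+1 <= lker f)%VS.
    by rewrite memv_ker fE => /eqP.
  apply/lie_spanP => u v _ vi; rewrite memv_ker fE.
  by rewrite lieC form1N -d1E al0 // oppr0.
rewrite d1E lieC form1N al0 ?oppr0 //.
by apply: memv_lie => //; apply: memvf.
Qed.

Lemma Vfilt_full i : lcs g i = 0%VS -> Vfilt g i = fullv.
Proof.
move=> i0; apply/vspaceP => al; rewrite memvf; apply/Vfilt_annihilator => x.
by rewrite i0 memv0 => /eqP ->; exact: (linear0 (form1_fun al)).
Qed.

Lemma ext2_full k : lcs g k = 0%VS -> ext 2 (Vfilt g k) = fullv.
Proof.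
move=> k0; apply/vspaceP => b; rewrite memvf; apply/ext2P.
  exact: Vfilt_annihilator.
by move=> x y; rewrite k0 memv0 => /eqP ->; rewrite form20l.
Qed.

(** [Vfilt g k.+1] is all of the dual, and by definition it is the preimage under [d] of the
    exterior square of [Vfilt g k]. *)
Lemma dCE_cocycle k (al : altform g 1) : lcs g k.+1 = 0%VS ->
  dCE g 1 al \in cocycles 2 (Vfilt g k).
Proof.
move=> k0; rewrite memv_cap memv_ker dCE_dCE1 eqxx /=.
have : al \in Vfilt g k.+1 by rewrite Vfilt_full // memvf.
by rewrite /= -memv_preim.
Qed.

Lemma Einf02E k : lcs g k.+1 = 0%VS ->
  Einf g k.+1 0 2 = quotv (lker (dCE g 2)) (cocycles 2 (Vfilt g k)).
Proof.
move=> k0; rewrite /Einf subn0 subn1 -pred_Sn.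
rewrite -[LHS]/(quotv (cocycles 2 (Vfilt g k.+1))
  (coboundaries 2 (Vfilt g k.+1) + cocycles 2 (Vfilt g k))); congr quotv.
  by rewrite /cocycles ext2_full // capvf.
(* The coboundaries are absorbed by the cocycles one filtration step below. *)
apply/addv_idPr/subvP => _ /memv_imgP[al _ ->]; exact: dCE_cocycle.
Qed.

End Filtration.

(** * Dimensions of quotients and of sums with a line *)

Lemma dim_quotv (K : fieldType) (vT : vectType K) (A B : {vspace vT}) :
  (B <= A)%VS -> (\dim (quotv A B) + \dim B)%N = \dim A.
Proof. by move=> sBA; rewrite -(dimv_cap_compl A B) (capv_idPr sBA) addnC. Qed.

Lemma dim_add_line (K : fieldType) (vT : vectType K) (v : vT) (U : {vspace vT}) :
  v \notin U -> \dim (<[v]> + U) = (\dim U).+1.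
Proof.
move=> vU; rewrite dimv_disjoint_sum.
  by rewrite dim_vline (contraNneq _ vU) // => ->; rewrite mem0v.
apply/eqP; rewrite -subv0; apply/subvP => _ /memv_capP[/vlineP[a ->] avU].
rewrite memv0 scaler_eq0; case: eqP avU => //= /eqP a0 avU.
by rewrite -(scalerK a0 v) rpredZ in vU.
Qed.

(** * Pullback of forms along a linear map *)

Section Pullback.
Variables (R : realType) (h g : lieAlgType R) (f : 'Hom(h, g)).

Section Degree.
Variable p : nat.

Fact pullback_is_form (c : altform g p) :
  is_form (fun x : 'I_p -> h => c (f \o x)).
Proof.
have fupd (x : 'I_p -> h) i u : f \o upd x i u = upd (f \o x) i (f u).
  by apply/funext => j; rewrite /= /upd; case: eqP.
apply/asboolP; split=> [x i a u v|x i j nij xij].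
  by rewrite !fupd linearP form_multilinear.
by apply: (form_alternating _ nij); rewrite /= xij.
Qed.

Definition pullback_form c : altform h p := Form (pullback_is_form c).

Fact pullback_form_linear : linear pullback_form.
Proof. by move=> a b c; apply/formP. Qed.
HB.instance Definition _ :=
  GRing.isLinear.Build R (altform g p) (altform h p) _ pullback_form
    pullback_form_linear.

Definition pullback : 'Hom(altform g p, altform h p) := linfun pullback_form.

Lemma pullbackE c x : pullback c x = c (f \o x).
Proof. by rewrite lfunE. Qed.

Lemma lker_pullback : limg f = fullv -> lker pullback == 0%VS.
Proof.
move=> f_surj; rewrite -subv0; apply/subvP => c; rewrite memv_ker memv0 => /eqP c0.
apply/eqP/formP => x.
have fK : f \o ((f^-1)%VF \o x) = x.
  by apply/funext => i /=; rewrite limg_lfunVK // f_surj memvf.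
by rewrite -fK -pullbackE c0.
Qed.

End Degree.

Lemma comp_args p (s : seq h) : f \o (args s : 'I_p -> h) = args [seq f u | u <- s].
Proof.
apply/funext => i; rewrite /= /args; case: (ltnP i (size s)) => si.
  by rewrite (nth_map 0).
by rewrite !nth_default ?size_map // linear0.
Qed.

Lemma pullback1 c u : pullback 1 c (args [:: u]) = c (args [:: f u]).
Proof. by rewrite pullbackE comp_args. Qed.

Lemma pullback2 c u v : pullback 2 c (args [:: u; v]) = c (args [:: f u; f v]).
Proof. by rewrite pullbackE comp_args. Qed.

Lemma dCE_pullback p c : (forall u v, f (lie u v) = lie (f u) (f v)) ->
  dCE h p (pullback p c) = pullback p.+1 (dCE g p c).
Proof.
move=> f_lie; apply/formP => x; rewrite pullbackE !dCE_E.
apply: eq_bigr => i _; apply: eq_bigr => j _; rewrite pullbackE /ce_args comp_args.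
by rewrite /= f_lie -map_comp.
Qed.

End Pullback.

(** * Lower central series and cocycles of the central extension *)

Section CentralExtensionCohomology.
Variables (R : realType) (n : lieAlgType R) (w : altform n 2).
Hypotheses (dw0 : dCE n 2 w = 0) (w_nondeg : Defs.nondegenerate w).
Local Notation E := (central_ext dw0).

Definition cext_fst : 'Hom(E, n) := linfun (fst : (n * R^o)%type -> n).
Definition cext_snd : 'Hom(E, R^o) := linfun (snd : (n * R^o)%type -> R^o).
Local Notation P := (pullback cext_fst).

Lemma cext_fstE u : cext_fst u = u.1. Proof. by rewrite lfunE. Qed.
Lemma cext_sndE u : cext_snd u = u.2. Proof. by rewrite lfunE. Qed.

Lemma cext_fst_lie u v : cext_fst (lie u v) = lie (cext_fst u) (cext_fst v).
Proof. by rewrite !cext_fstE. Qed.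

Lemma limg_cext_fst : limg cext_fst = fullv.
Proof.
apply/vspaceP => x; rewrite memvf; apply/memv_imgP.
by exists ((x, 0) : E); rewrite ?memvf ?cext_fstE.
Qed.

Lemma lcs_cext_fst i : (cext_fst @: lcs E i)%VS = lcs n i.
Proof.
elim: i => [|i IH]; first exact: limg_cext_fst.
apply/eqP; rewrite !lcsE eqEsubv; apply/andP; split.
  apply/subvP => _ /memv_imgP[u uS ->]; rewrite memv_preim.
  move: u uS; apply/subvP/lie_spanP => u v _ vi.
  rewrite -memv_preim cext_fst_lie; apply: (memv_lie (V := lcs n i)); first exact: memvf.
  by rewrite -IH memv_img.
apply/lie_spanP => x y _; rewrite -IH => /memv_imgP[u ui ->].
have -> : x = cext_fst ((x, 0) : E) by rewrite cext_fstE.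
by rewrite -cext_fst_lie memv_img // memv_lie ?memvf.
Qed.

(** From here on [n] has index [k.+1], so this [k] is one less than the index in the overview. *)
Variable k : nat.
Hypotheses (nk0 : lcs n k.+1 = 0%VS) (nk : lcs n k <> 0%VS).

Definition cext_z : E := (0, 1).

(** Pair a nonzero [x] of the last nonzero term with some [y] such that [w] is nonzero on [y, x]. As
    [lie y x] vanishes in [n], the bracket of lifts is a nonzero multiple of [cext_z]. *)
Lemma cext_z_lcs : cext_z \in lcs E k.+1.
Proof.
have [x xk xn0] : exists2 x, x \in lcs n k & x != 0.
  by exists (vpick (lcs n k)); rewrite ?memv_pick // vpick0; apply/eqP.
have [y yx] : exists y, w (args [:: y; x]) != 0.
  apply: contrapT => /forallNP H; case/eqP: xn0; apply: w_nondeg => y.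
  by rewrite form2C; apply/eqP; rewrite oppr_eq0; apply/negPn/negP/H.
move: (xk); rewrite -lcs_cext_fst => /memv_imgP[u uk]; rewrite cext_fstE => xu.
have : lie ((y, 0) : E) u \in lcs E k.+1 by rewrite memv_lie ?memvf.
rewrite lie_cextE /= -xu.
have -> : lie y x = 0.
  by apply/eqP; rewrite -memv0 -nk0 memv_lie ?memvf.
set c := w _ => cE; have -> : cext_z = c^-1 *: ((0, c) : E).
  by congr (_, _); rewrite ?scaler0 // -[RHS]/(_ * _) mulVf.
exact: rpredZ.
Qed.

(** Vectors with the same first component differ by a multiple of [cext_z], which lies in all terms
    up to [k.+1]. *)
Lemma mem_lcs_cext i (u : E) : (i <= k.+1)%N ->
  (u \in lcs E i) = (u.1 \in lcs n i).
Proof.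
move=> ik; rewrite -cext_fstE; apply/idP/idP => [ui|].
  by rewrite -lcs_cext_fst memv_img.
rewrite -lcs_cext_fst => /memv_imgP[v vi]; rewrite !cext_fstE => uv.
have -> : u = v + (u.2 - v.2) *: cext_z.
  case: u v uv {vi} => u1 u2 [v1 v2] /= ->; congr (_, _) => /=.
    by rewrite scaler0 addr0.
  by rewrite -[_ *: _]/(_ * _) mulr1 addrC subrK.
by rewrite rpredD // rpredZ // (subvP (lcs_le _ ik)) ?cext_z_lcs.
Qed.

Lemma cext_step_nilpotent : step_nilpotent E k.+2.
Proof.
split=> [|/= E0]; last first.
  have := cext_z_lcs; rewrite [lcs _ _]E0 memv0 => /eqP[/eqP].
  by rewrite oner_eq0.
apply/eqP; rewrite lcsE -subv0; apply/lie_spanP => u v _.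
rewrite mem_lcs_cext // nk0 memv0 => /eqP v0.
by rewrite memv0 lie_cextE v0 liex0 form2C form20l oppr0.
Qed.

(** A linear section of [cext_fst] that is not a Lie homomorphism, so [dCE_pullback] does not apply
    to it. *)
Definition cext_inl_fun (x : n) : E := (x, 0).

Fact cext_inl_fun_linear : linear cext_inl_fun.
Proof. by move=> a x y; congr (_, _); rewrite /= scaler0 addr0. Qed.
HB.instance Definition _ :=
  GRing.isLinear.Build R n E _ cext_inl_fun cext_inl_fun_linear.

Definition cext_inl : 'Hom(n, E) := linfun cext_inl_fun.

Lemma cext_inlE x : cext_inl x = (x, 0).
Proof. by rewrite lfunE. Qed.

Lemma cext_decomp (u : E) : u = u.2 *: cext_z + cext_inl u.1.
Proof.
rewrite cext_inlE; case: u => x t; congr (_, _) => /=; first by rewrite scaler0 add0r.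
by rewrite -[_ *: _]/(_ * _) mulr1 addr0.
Qed.

(** Since [cext_z] lies in [lcs E i], it is in the radical of every form on the left, which is
    therefore the pullback of its restriction to [n]. *)
Lemma cocycles_cext i : (i <= k.+1)%N ->
  cocycles 2 (Vfilt E i) = (P 2 @: cocycles 2 (Vfilt n i))%VS.
Proof.
move=> ik; apply/vspaceP => b; apply/idP/memv_imgP => [|[c]].
  rewrite memv_cap memv_ker => /andP[/eqP db].
  move=> /(ext2P (@Vfilt_annihilator _ _ _)) bi.
  have zi : cext_z \in lcs E i by rewrite (subvP (lcs_le _ ik)) ?cext_z_lcs.
  have bE : b = P 2 (pullback cext_inl 2 b).
    apply: form2_eq => u v; rewrite !pullback2 !cext_fstE.
    rewrite {1}(cext_decomp u) {1}(cext_decomp v) form2Dl bi // mulr0 add0r.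
    by rewrite form2Dr form2C bi // oppr0 mulr0 add0r.
  exists (pullback cext_inl 2 b) => //; rewrite memv_cap memv_ker.
  apply/andP; split.
    (* Closedness of the restriction is checked after pulling back to [E], by injectivity of the
       pullback in degree 3. *)
    rewrite -memv0 -(eqP (lker_pullback 3 limg_cext_fst)) memv_ker.
    by rewrite -(dCE_pullback _ cext_fst_lie) -bE db.
  apply/(ext2P (@Vfilt_annihilator _ _ _)) => x y xi.
  by rewrite pullback2 bi // mem_lcs_cext // cext_inlE.
rewrite memv_cap memv_ker => /andP[/eqP dc].
move=> /(ext2P (@Vfilt_annihilator _ _ _)) ci ->.
rewrite memv_cap memv_ker (dCE_pullback _ cext_fst_lie) dc linear0 eqxx /=.
apply/(ext2P (@Vfilt_annihilator _ _ _)) => u v.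
by rewrite mem_lcs_cext // -cext_fstE pullback2 => /ci.
Qed.

Lemma dCE_cext_snd : dCE E 1 (hom_form cext_snd) = P 2 w.
Proof.
by apply: form2_eq => u v; rewrite d1E pullback2 /= cext_sndE !cext_fstE.
Qed.

Lemma dCE_cext (al : altform E 1) : dCE E 1 al =
  P 2 (al (args [:: cext_z]) *: w + dCE n 1 (pullback cext_inl 1 al)).
Proof.
apply: form2_eq => u v; rewrite d1E pullback2 !cext_fstE.
rewrite -[RHS]/(_ * w _ + dCE n 1 _ _) d1E pullback1.
have -> : lie u v = w (args [:: u.1; v.1]) *: cext_z + cext_inl (lie u.1 v.1).
  exact: cext_decomp.
by rewrite [in RHS]mulrC; exact: (linearP (form1_fun al)).
Qed.

(** By [dCE_cext] a coboundary of [E] is the pullback of a multiple of [w] plus an exact form of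
    [n], and the latter is absorbed by [dCE_cocycle]. Conversely the pullback of [w] is exact, and
    it vanishes on [lcs E k.+1], whose first components are zero. *)
Lemma coboundaries_cext :
  (coboundaries 2 (Vfilt E k.+1) + cocycles 2 (Vfilt E k))%VS =
  (P 2 @: (<[w]> + cocycles 2 (Vfilt n k)))%VS.
Proof.
rewrite limgD -cocycles_cext //; apply/eqP; rewrite eqEsubv !subv_add !addvSr !andbT.
apply/andP; split.
  apply/subvP => _ /memv_imgP[al _ ->]; rewrite dCE_cext linearP memv_add //.
    by rewrite limg_line rpredZ // memv_line.
  by rewrite cocycles_cext // memv_img // dCE_cocycle.
apply: subv_trans (addvSl _ _).
rewrite limg_line -memvE -dCE_cext_snd memv_img // -memv_preim.
apply/(ext2P (@Vfilt_annihilator _ _ _)) => u v.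
rewrite mem_lcs_cext // nk0 memv0 => /eqP u0.
by rewrite dCE_cext_snd pullback2 cext_fstE u0 form20l.
Qed.

Lemma w_notin_cocycles : w \notin cocycles 2 (Vfilt n k).
Proof.
apply/negP; rewrite memv_cap => /andP[_ /(ext2P (@Vfilt_annihilator _ _ _)) w0].
apply: nk; apply/eqP; rewrite -subv0; apply/subvP => x xk.
by rewrite memv0; apply/eqP/w_nondeg => y; apply: w0.
Qed.

Lemma dim_Einf_cext :
  \dim (Einf n k.+1 0 2) = (\dim (Einf E k.+2 1 1) + 1)%N.
Proof.
rewrite Einf02E //.
have -> : \dim (Einf E k.+2 1 1) = \dim (quotv (P 2 @: lker (dCE n 2))
    (P 2 @: (<[w]> + cocycles 2 (Vfilt n k)))).
  (* The filtration indices of [E] are [k.+2 - 1] and [k.+2 - 1 - 1], that is [k.+1] and [k]; at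
     [k.+1] the exterior square for [n] is everything, so the numerator is the pullback of all
     cocycles. *)
  rewrite -coboundaries_cext /Einf !subn1 /=.
  by rewrite -(capvf (lker (dCE n 2))) -(ext2_full nk0) -cocycles_cext.
have sZ : (<[w]> + cocycles 2 (Vfilt n k) <= lker (dCE n 2))%VS.
  by rewrite subv_add -memvE memv_ker dw0 eqxx capvSl.
have dimP U : \dim (P 2 @: U) = \dim U.
  by rewrite limg_dim_eq // (eqP (lker_pullback 2 limg_cext_fst)) capv0.
(* Both quotients have a numerator of the same dimension; the denominators differ by the line of
   [w]. *)
have := dim_quotv (limgS (P 2) sZ).
rewrite !dimP dim_add_line ?w_notin_cocycles //.
have := dim_quotv (subv_trans (addvSr _ _) sZ).
by move=> <- /eqP; rewrite addnS -addSn eqn_add2r addn1 => /eqP.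
Qed.

End CentralExtensionCohomology.

Theorem lemma3p1 (R : realType) (n : lieAlgType R) (k : nat)
    (hk : step_nilpotent n k) (w : altform n 2) (hw : symplectic w) :
  exists kt : nat,
    [/\ step_nilpotent (central_ext (proj1 hw)) kt,
        \dim (Einf n k 0 2) = (\dim (Einf (central_ext (proj1 hw)) kt 1 1) + 1)%N
      & Einf n k 0 2 != 0%VS].
Proof.
have := step_nilpotent_gt0 hk; case: k hk => // k [nk0 nk] _.
have dimE := dim_Einf_cext (proj1 hw) (proj2 hw) nk0 nk.
have stepE := cext_step_nilpotent (proj1 hw) (proj2 hw) nk0 nk.
by exists k.+2; split; rewrite // -dimv_eq0 dimE addn1.
Qed.
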